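(* Let $k,n\ge 1$ be integers. The collection of products $$\{\,p_{a^{1}}\cdots p_{a^{r}} \;:\; |a^{1}|+\cdots+|a^{r}|\le n+1\,\},$$ where $[a^1,\dots,a^r]$ ranges over the finite multisets (the empty one included, giving the product $1$) of vectors $a^i\in\mathbb{Z}_{\ge 0}^k$ with $0<|a^i|\le n$ and total size at most $n+1$, is a basis of the complex vector space $\mathcal{R}_{\le n+1}^{S_n}$ (with distinct multisets giving distinct basis elements).
   Context: $\mathcal{R}=\mathbb{C}[x_{i,j}: 1\le i\le k,\ 1\le j\le n]$ is the polynomial ring in $k$ sets of $n$ variables. The symmetric group $S_n$ acts diagonally by algebra automorphisms: $s\cdot x_{i,j}=x_{i,s(j)}$. $\mathcal{R}_{\le d}$ is the space of polynomials of total degree at most $d$, and $\mathcal{R}_{\le d}^{S_n}$ is its subspace of $S_n$-invariants. For $a=(a_1,\dots,a_k)\in\mathbb{Z}_{\ge0}^k$ put $|a|=a_1+\cdots+a_k$. The polarized power sums are $$p_a=\sum_{j=1}^n x_{1,j}^{a_1}\cdots x_{k,j}^{a_k},\qquad 0<|a|\le n.$$ *)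

(* Defs.v *)
From mathcomp Require Import all_boot all_algebra all_fingroup.
From mathcomp Require Import reals complex finmap multiset mpoly.

Set Implicit Arguments.
Unset Strict Implicit.
Unset Printing Implicit Defensive.

Import GRing.Theory.

Local Open Scope ring_scope.

Section Basis.

Variables (F : fieldType) (V : lmodType F) (I : choiceType).

(* The vectors e i, for i in D, form a basis of the subspace U.  The condition
   is on the indexed family, so e is in particular injective on D. *)
Definition is_basis (U : {pred V}) (D : {pred I}) (e : I -> V) : Prop :=
  [/\ forall i, i \in D -> e i \in U,
      forall (s : seq I) (c : I -> F),
        uniq s -> {subset s <= D} ->
        \sum_(i <- s) c i *: e i = 0 -> forall i, i \in s -> c i = 0
    & forall v, v \in U ->
        exists (s : seq I) (c : I -> F),
          [/\ uniq s, {subset s <= D} & v = \sum_(i <- s) c i *: e i]].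

End Basis.

Section PolarizedPowerSums.

Variables (K : fieldType) (k n : nat).

(* The polynomial ring in the k * n variables x_{i,j}, where x_{i,j} is the
   variable of index mxvec_index i j. *)
Definition kpoly := {mpoly K[k * n]}.

Definition xvar (i : 'I_k) (j : 'I_n) : kpoly := 'X_(mxvec_index i j).

Definition sym_act (s : 'S_n) (p : kpoly) : kpoly :=
  p \mPo [tuple mxvec (\matrix_(i < k, j < n) xvar i (s j)) 0 l | l < k * n].

Lemma sym_act_xvar (s : 'S_n) i j : sym_act s (xvar i j) = xvar i (s j).
Proof. by rewrite /sym_act comp_mpolyXU -tnth_nth tnth_mktuple mxvecE mxE. Qed.

(* msize p is 1 + the total degree of p, and 0 if p = 0. *)
Definition sym_inv_le (d : nat) : {pred kpoly} :=
  [pred p | (msize p <= d.+1)%N & [forall s : 'S_n, sym_act s p == p]].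

(* Exponent vectors a = (a_1, ..., a_k) are the multinomials 'X_{1..k}, with
   |a| = mdeg a. *)
Definition psum (a : 'X_{1..k}) : kpoly :=
  \sum_(j < n) \prod_(i < k) xvar i j ^+ a i.

(* A multiset coerces to a sequence listing its elements with multiplicity. *)
Definition psum_prod (A : {mset 'X_{1..k}}%mset) : kpoly :=
  \prod_(a <- A) psum a.

Definition psum_index (d : nat) : {pred {mset 'X_{1..k}}%mset} :=
  [pred A : {mset 'X_{1..k}}%mset |
    all (fun a => 0 < mdeg a <= n)%N A & (\sum_(a <- A) mdeg a <= d)%N].

End PolarizedPowerSums.

Arguments sym_inv_le K k n d : clear implicits.
Arguments psum_prod K {k} n A.
Arguments psum_index k n d : clear implicits.

(* Main.v *)
Require Import Defs.
From mathcomp Require Import all_boot all_algebra all_fingroup.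
From mathcomp Require Import reals complex finmap multiset mpoly ring.

(* Write p_A for the product of the p_a, a in A, and M_A for the sum over
   injections of the parts of A into the n columns of the corresponding
   monomial; the M_A with n parts (zero parts allowed) span the invariants.
   Splitting on the column of one part gives
     M_(a, A) = p_a M_A - sum_i M_(A with a added to its i-th part),
   so M_A is a combination of products p_B.  Modulo products of at least two
   p_b, the same recursion gives M_A = (-1)^(r-1) (r-1)! p_(sum A), r = #A.  For
   r = n + 1 there are no injections, so p_b with |b| = n + 1 is a combination
   of products of lower power sums.

   For independence, p_A = sum over maps f from the parts of A to the columns.
   If A has at most n parts, put them in different columns: among the p_B with
   no more parts than A, only p_A contains the resulting monomial.  If A has
   n + 1 parts, a linear form that only sees the total exponent vector and the
   number of nonzero columns of a monomial separates p_A from all others. *)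

Set Implicit Arguments.
Unset Strict Implicit.
Unset Printing Implicit Defensive.

Import GRing.Theory Num.Theory.
Local Open Scope ring_scope.

Lemma big_tuple_cons (T : finType) (V : nmodType) r (P : pred (seq T))
    (F : seq T -> V) :
  \sum_(t : r.+1.-tuple T | P t) F t =
  \sum_(t : r.-tuple T) \sum_(j | P (j :: t)) F (j :: t).
Proof.
rewrite (pair_big_dep xpredT (fun (t : r.-tuple T) j => P (j :: t))
  (fun (t : r.-tuple T) j => F (j :: t))) /=.
rewrite (reindex (fun p : r.-tuple T * T => [tuple of p.2 :: p.1])) //=.
exists (fun t : r.+1.-tuple T => (behead_tuple t, thead t)) => [[t j] _|t _] /=.
  by congr (_, _); apply: val_inj.
by rewrite [RHS]tuple_eta.
Qed.

(** * Exponents of monomials, column by column *)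

Section Monomials.
Variables k n : nat.
Implicit Types (a : 'X_{1..k}) (A : seq 'X_{1..k}) (t : seq 'I_n).
Implicit Types (m : 'X_{1..(k * n)%N}) (j : 'I_n).

Definition mcol m j : 'X_{1..k} := [multinom m (mxvec_index i j) | i < k].

Definition colmnm j a : 'X_{1..(k * n)%N} :=
  (\sum_(i < k) U_(mxvec_index i j) *+ a i)%MM.

Lemma mxvec_index_eq (i i' : 'I_k) j j' :
  (mxvec_index i j == mxvec_index i' j') = (i == i') && (j == j').
Proof.
rewrite (inj_eq (@cast_ord_inj _ _ _)) (inj_eq enum_rank_inj).
by rewrite -[RHS]/((i, j) == (i', j')).
Qed.

Lemma mcolD m1 m2 j : mcol (m1 + m2)%MM j = (mcol m1 j + mcol m2 j)%MM.
Proof. by apply/mnmP => i; rewrite !(mnmE, mnmDE). Qed.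

Lemma mcol0 j : mcol 0%MM j = 0%MM.
Proof. by apply/mnmP => i; rewrite !mnmE. Qed.

Lemma mcol_sum (I : Type) (r : seq I) (F : I -> 'X_{1..(k * n)%N}) j :
  mcol (\sum_(x <- r) F x)%MM j = (\sum_(x <- r) mcol (F x) j)%MM.
Proof. exact: (big_morph (mcol^~ j) (fun m m' => mcolD m m' j) (mcol0 j)). Qed.

Lemma mcol_colmnm j a j' :
  mcol (colmnm j a) j' = if j == j' then a else 0%MM.
Proof.
apply/mnmP => i; rewrite mnmE mnm_sumE (bigD1 i) //= big1 => [|i' ne].
  rewrite addn0 mulmnE mnm1E mxvec_index_eq eqxx /=.
  by case: eqP; rewrite ?mul1n // mnm0E.
by rewrite mulmnE mnm1E mxvec_index_eq (negbTE ne).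
Qed.

Lemma mcol_inj m1 m2 : (forall j, mcol m1 j = mcol m2 j) -> m1 = m2.
Proof.
move=> h; apply/mnmP => l; case/mxvec_indexP: l => i j.
by have /mnmP/(_ i) := h j; rewrite !mnmE.
Qed.

Lemma sum_colmnm m : (\sum_j colmnm j (mcol m j))%MM = m.
Proof.
apply: mcol_inj => j; rewrite mcol_sum (bigD1 j) //= big1 => [|j' ne].
  by rewrite mcol_colmnm eqxx addm0.
by rewrite mcol_colmnm (negbTE ne).
Qed.

Lemma mdeg_colmnm j a : mdeg (colmnm j a) = mdeg a.
Proof.
rewrite mdeg_sum mdegE; apply: eq_bigr => i _.
by rewrite mdegMn mdeg1 mul1n.
Qed.

(** A map from the parts of [A] to the columns is encoded by the list [t] of its values; parts sent
    to the same column add up there. *)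
Fixpoint mnm_of t A : 'X_{1..(k * n)%N} :=
  match t, A with
  | j :: t', a :: A' => (colmnm j a + mnm_of t' A')%MM
  | _, _ => 0%MM
  end.

Lemma mdeg_mnm_of t A :
  size t = size A -> mdeg (mnm_of t A) = (\sum_(a <- A) mdeg a)%N.
Proof.
elim: A t => [|a A IH] [|j t] //= => [_|[/IH e]].
  by rewrite big_nil mdeg0.
by rewrite big_cons mdegD mdeg_colmnm e.
Qed.

Lemma mcol_mnm_of_notin t A j : j \notin t -> mcol (mnm_of t A) j = 0%MM.
Proof.
elim: t A => [|j' t IH] [|a A] //=; rewrite ?mcol0 // inE negb_or.
by case/andP=> ne /IH e; rewrite mcolD e mcol_colmnm eq_sym (negbTE ne) addm0.
Qed.

(** Positive parts cannot cancel, so the image of the map can be read off its monomial. *)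
Lemma mcol_mnm_of_eq0 t A j :
  size t = size A -> all (fun a => 0 < mdeg a)%N A ->
  (mcol (mnm_of t A) j == 0%MM) = (j \notin t).
Proof.
elim: A t => [|a A IH] [|j' t] //=; first by rewrite mcol0 eqxx.
move=> [/IH{}IH] /andP[a0 /IH e]; rewrite mcolD mnmD_eq0 e mcol_colmnm inE.
rewrite negb_or [j == j']eq_sym; case: (j' == j); last by rewrite eqxx.
by rewrite -mdeg_eq0 eqn0Ngt a0.
Qed.

(** Under an injective map each occupied column holds a single part. *)
Lemma map_mcol_mnm_of t A :
  uniq t -> size t = size A -> map (mcol (mnm_of t A)) t = A.
Proof.
elim: A t => [|a A IH] [|j t] //= /andP[jt ut] [/IH e].
rewrite mcolD mcol_mnm_of_notin // mcol_colmnm eqxx addm0; congr (_ :: _).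
rewrite -[RHS]e //; apply/eq_in_map => j' j't.
rewrite mcolD mcol_colmnm; case: eqP => [ee|_]; last by rewrite add0m.
by rewrite ee j't in jt.
Qed.

Lemma sum_mcol_mnm_of t A :
  size t = size A ->
  (\sum_j mcol (mnm_of t A) j)%MM = (\sum_(a <- A) a)%MM.
Proof.
elim: A t => [|a A IH] [|j t] //= => [_|[/IH e]].
  by rewrite big_nil big1 // => j _; rewrite mcol0.
under eq_bigr do rewrite mcolD mcol_colmnm.
rewrite big_split /= e big_cons; congr (_ + _)%MM.
by rewrite -big_mkcond (big_pred1 j) // => j'; rewrite eq_sym.
Qed.

End Monomials.

(** * Products of power sums and sums over injections *)

Section PowerSumProducts.
Variables (K : numFieldType) (k n : nat).
Implicit Types (a : 'X_{1..k}) (A : seq 'X_{1..k}) (t : seq 'I_n) (j : 'I_n).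

Lemma xvar_prod j a :
  \prod_(i < k) xvar K i j ^+ a i = 'X_[colmnm j a] :> kpoly K k n.
Proof. exact: mprodXnE. Qed.

Lemma psumE a : psum K n a = \sum_j 'X_[colmnm j a].
Proof. by apply: eq_bigr => j _; rewrite xvar_prod. Qed.

Lemma psum0 : psum K n (0%MM : 'X_{1..k}) = n%:R.
Proof.
rewrite /psum (eq_bigr (fun=> 1)) ?sumr_const ?card_ord // => j _.
by rewrite big1 // => i _; rewrite mnm0E expr0.
Qed.

(** Lists instead of multisets let parts be split off one by one; zero parts are allowed. *)
Definition pprod A : kpoly K k n := \prod_(a <- A) psum K n a.

Lemma pprod_cons a A : pprod (a :: A) = psum K n a * pprod A.
Proof. exact: big_cons. Qed.

(** Expanding the product picks one column for each part. *)
Lemma pprodE r A :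
  size A = r -> pprod A = \sum_(t : r.-tuple 'I_n) 'X_[mnm_of t A].
Proof.
elim: r A => [|r IH] [|a A] //=.
  move=> _; rewrite /pprod big_nil (big_pred1 [tuple]) ?mpolyX0 // => t.
  by rewrite [t]tuple0 /= eqxx.
move=> [/IH e]; rewrite pprod_cons e psumE mulr_sumr.
rewrite (big_tuple_cons r xpredT (fun t => 'X_[mnm_of t (a :: A)])) /=.
apply: eq_bigr => t _; rewrite mulr_suml.
by apply: eq_bigr => j _; rewrite -mpolyXD.
Qed.

(** This is M_A, with [r] meant to be the size of [A]. *)
Definition injsum r A : kpoly K k n :=
  \sum_(t : r.-tuple 'I_n | uniq t) 'X_[mnm_of t A].

(** Merging [a] into a part amounts to placing [a] in that part's column; this accounts for the
    non-injective extensions in [injsum_cons]. *)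
Lemma mnm_of_set_nth t A a i j0 :
  (i < size A)%N -> size t = size A ->
  mnm_of t (set_nth 0%MM A i (a + nth 0%MM A i)%MM) =
  (colmnm (nth j0 t i) a + mnm_of t A)%MM.
Proof.
elim: A t i => [|b A IH] [|j t] // [|i] /= => [_ _|iA [tA]].
  rewrite addmA; congr (_ + _)%MM; apply: mcol_inj => j'.
  by rewrite mcolD !mcol_colmnm; case: eqP; rewrite ?addm0.
by rewrite IH // !addmA; congr (_ + _)%MM; rewrite addmC.
Qed.

(* An injective r-tuple is extended by an arbitrary index j; either the result
   is still injective, or j is the i-th entry for a unique i. *)
Lemma injsum_cons r a A : size A = r ->
  injsum r.+1 (a :: A) = psum K n a * injsum r A -
    \sum_(i < r) injsum r (set_nth 0%MM A i (a + nth 0%MM A i)%MM).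
Proof.
move=> sA; apply/eqP; rewrite eq_sym subr_eq; apply/eqP.
rewrite /injsum exchange_big /=.
rewrite (big_tuple_cons r (fun t => uniq t) (fun t => 'X_[mnm_of t (a :: A)])).
rewrite mulr_sumr [X in X + _](bigID (fun t : r.-tuple 'I_n => uniq t)) /=.
rewrite [X in _ + X + _]big1 ?addr0 => [|t ut]; last first.
  by apply: big1 => j; rewrite (negbTE ut) andbF.
rewrite -big_split; apply: eq_bigr => t ut /=; rewrite ut psumE mulr_suml.
rewrite (bigID (fun j => j \notin t)) /=; congr (_ + _).
  by apply: eq_big => [j|j _]; rewrite ?andbT // mpolyXD.
rewrite (eq_bigl (mem t)) => [|j]; last by rewrite negbK.
rewrite -big_uniq //= big_tuple; apply: eq_bigr => i _.
by rewrite (mnm_of_set_nth _ (tnth t i)) ?sA ?size_tuple // -tnth_nth mpolyXD.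
Qed.

Lemma injsum0 : injsum 0 [::] = 1.
Proof.
rewrite /injsum (big_pred1 [tuple]) ?mpolyX0 // => t.
by rewrite [t]tuple0 /= eqxx.
Qed.

Lemma injsum_gt r A : (n < r)%N -> injsum r A = 0.
Proof.
move=> nr; apply: big_pred0 => t; apply: contraTF nr => /card_uniqP e.
by rewrite -leqNgt -[X in (_ <= X)%N](card_ord n) -(size_tuple t) -e max_card.
Qed.

End PowerSumProducts.

(** * Linear spans *)

Section Span.
Variables (K : fieldType) (V : lmodType K).
Implicit Types (P Q : V -> Prop) (v w : V).

(** The inductive form supports induction on combinations; [in_span_uniq] converts it to the indexed
    form used in [is_basis]. *)
Inductive in_span P : V -> Prop :=
| in_span0 : in_span P 0
| in_spanS c u v : P u -> in_span P v -> in_span P (c *: u + v).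

Lemma in_span_gen P v : P v -> in_span P v.
Proof. by move=> Pv; rewrite -[v]addr0 -[v]scale1r; apply: in_spanS => //; left. Qed.

Lemma in_spanD P v w : in_span P v -> in_span P w -> in_span P (v + w).
Proof.
move=> + Pw; elim=> [|c u v' Pu _ IH]; rewrite ?add0r // -addrA.
exact: in_spanS.
Qed.

Lemma in_spanZ P c v : in_span P v -> in_span P (c *: v).
Proof.
elim=> [|c' u v' Pu _ IH]; first by rewrite scaler0; left.
by rewrite scalerDr scalerA; apply: in_spanS.
Qed.

Lemma in_spanB P v w : in_span P v -> in_span P w -> in_span P (v - w).
Proof. by move=> Pv /(in_spanZ (-1)); rewrite scaleN1r; apply: in_spanD. Qed.

Lemma in_span_sum P (I : Type) (r : seq I) (C : pred I) (F : I -> V) :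
  (forall i, C i -> in_span P (F i)) -> in_span P (\sum_(i <- r | C i) F i).
Proof. by move=> PF; elim/big_ind: _ => //; [left | apply: in_spanD]. Qed.

Lemma in_span_trans P Q v :
  (forall u, P u -> in_span Q u) -> in_span P v -> in_span Q v.
Proof.
move=> PQ; elim=> [|c u w /PQ Qu _ Qw]; first by left.
by apply: in_spanD => //; apply: in_spanZ.
Qed.

Lemma in_span_uniq (I : choiceType) (D : {pred I}) (e : I -> V) v :
  in_span (fun u => exists2 i, i \in D & u = e i) v ->
  exists (s : seq I) (c : I -> K),
    [/\ uniq s, {subset s <= D} & v = \sum_(i <- s) c i *: e i].
Proof.
elim=> [|x _ w [i iD ->] _ [s [c [us sD ->]]]].
  by exists [::], (fun=> 0); rewrite big_nil.
(* One formula serves both cases: [x] is added to the old coefficient of [i], taken as 0 when [i] is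
   not in [s]. *)
pose c' j := (if j == i then x else 0) + (if j \in s then c j else 0).
exists (if i \in s then s else i :: s), c'.
have cE : \sum_(j <- s | j != i) c' j *: e j = \sum_(j <- s | j != i) c j *: e j.
  rewrite big_seq_cond [RHS]big_seq_cond; apply: eq_bigr => j /andP[js ji].
  by rewrite /c' js (negbTE ji) add0r.
case: ifP => is_; split=> //=; rewrite ?is_ //.
- by rewrite !(bigD1_seq i is_) //= cE addrA -scalerDl /c' is_ eqxx.
- by move=> j; rewrite inE => /orP[/eqP->|/sD].
rewrite big_cons /c' eqxx is_ addr0; congr (_ + _).
rewrite big_seq [RHS]big_seq; apply: eq_bigr => j js; rewrite js.
by case: eqP js is_ => [-> ->|_ _ _] //; rewrite add0r.
Qed.

End Span.

Lemma in_span_mull (K : fieldType) (V : algType K) (P Q : V -> Prop) (u v : V) :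
  (forall w, P w -> Q (u * w)) -> in_span P v -> in_span Q (u * v).
Proof.
move=> PQ; elim=> [|c w w' /PQ Qw _ IH]; first by rewrite mulr0; left.
by rewrite mulrDr -scalerAr; apply: in_spanS.
Qed.

(** * Spanning: from sums over injections to products of power sums *)

Section Spanning.
Variables (K : numFieldType) (k n : nat).
Implicit Types (a b : 'X_{1..k}) (A B : seq 'X_{1..k}).
Implicit Types (q : pred 'X_{1..k}) (d : nat) (v : kpoly K k n).

Let pos a := (0 < mdeg a)%N.

Lemma sum_set_nth A a i : (i < size A)%N ->
  (\sum_(x <- set_nth 0%MM A i (a + nth 0%MM A i)) x)%MM =
  (a + \sum_(x <- A) x)%MM.
Proof.
elim: A i => [|x A IH] [|i] //= iA; rewrite !big_cons ?addmA //.
by rewrite IH // !addmA; congr (_ + _)%MM; rewrite addmC.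
Qed.

Lemma all_set_nth q A x i :
  (i < size A)%N -> q x -> all q A -> all q (set_nth 0%MM A i x).
Proof.
move=> + qx; elim: A i => [|y A IH] [|i] //= iA /andP[qy qA].
  by rewrite qx.
by rewrite qy IH.
Qed.

Lemma size_set_nth_lt A x i :
  (i < size A)%N -> size (set_nth 0%MM A i x) = size A.
Proof. by move=> iA; rewrite size_set_nth; apply/maxn_idPr. Qed.

(** [q] is instantiated by positivity and by [predT], the latter for monomials with empty
    columns. *)
Definition pprod_of q d v : Prop :=
  exists B, [/\ all q B, (\sum_(b <- B) mdeg b)%N = d & v = pprod K n B].

Definition pprod_decomposable d v : Prop :=
  exists B, [/\ all pos B, (\sum_(b <- B) mdeg b)%N = d, (1 < size B)%N
             & v = pprod K n B].

(** Each use of [injsum_cons] lowers the number of parts by one; merged parts stay in [q] by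
    additivity. *)
Lemma injsum_in_span q r A :
  (forall a b, q a -> q b -> q (a + b)%MM) -> size A = r -> all q A ->
  in_span (pprod_of q (\sum_(a <- A) mdeg a)) (injsum K n r A).
Proof.
move=> qD; elim: r A => [|r IH] [|a A] //=.
  move=> _ _; apply: in_span_gen; exists [::]; split=> //.
  by rewrite /pprod big_nil injsum0.
move=> [sA] /andP[qa qA]; rewrite injsum_cons // big_cons; apply: in_spanB.
  apply: in_span_mull (IH A sA qA) => _ [B [qB <- ->]].
  by exists (a :: B); rewrite /= qa big_cons pprod_cons.
apply: in_span_sum => i _; have iA : (i < size A)%N by rewrite sA.
have -> : (mdeg a + \sum_(b <- A) mdeg b)%N =
    (\sum_(b <- set_nth 0%MM A i (a + nth 0%MM A i)%MM) mdeg b)%N.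
  by rewrite -[RHS]mdeg_sum sum_set_nth // mdegD mdeg_sum.
apply: IH; first by rewrite size_set_nth_lt.
by apply: all_set_nth => //; apply: qD => //; apply: (allP qA); rewrite mem_nth.
Qed.

(** In [injsum_cons] the product term is decomposable, and each merged list has the same total and
    one part fewer. The coefficient is thus multiplied by minus the number of merged lists, which
    gives the signed factorial. *)
Lemma injsum_mod_decomposable r A : size A = r.+1 -> all pos A ->
  in_span (pprod_decomposable (\sum_(a <- A) mdeg a))
    (injsum K n r.+1 A
       - ((-1) ^+ r * r`!%:R) *: psum K n (\sum_(a <- A) a)%MM).
Proof.
elim: r A => [|r IH] [|a A] //=.
  move=> [/size0nil->] _; rewrite injsum_cons // injsum0 big_ord0 !big_seq1.
  by rewrite subr0 !mulr1 scale1r subrr; left.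
move=> [sA] /andP[a0 A0]; rewrite injsum_cons // !big_cons.
set p := psum _ _ (_ + _)%MM; set c := (-1) ^+ r * r`!%:R : K.
have -> : (-1) ^+ r.+1 * r.+1`!%:R = - (c *+ r.+1) :> K.
  by rewrite /c factS natrM exprS mulN1r mulNr -mulrnAr mulr_natl.
rewrite scaleNr opprK -scalerMnl -addrA.
(* One copy of [c *: p] is paired with each merged list, ready for the induction hypothesis. *)
have -> : (c *: p) *+ r.+1 = \sum_(i < r.+1) (c *: p) by rewrite sumr_const card_ord.
rewrite [- _ + _]addrC -opprB -sumrB; apply: in_spanB.
  have pD x y : pos x -> pos y -> pos (x + y)%MM.
    by rewrite /pos mdegD addn_gt0 => ->.
  apply: in_span_mull (injsum_in_span pD sA A0) => _ [B [B0 dB ->]].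
  exists (a :: B); rewrite /= a0 big_cons pprod_cons dB; split=> //.
  (* [B] is nonempty, since its degree is that of [A], which has a positive part. *)
  case: B dB {B0} => // /esym/eqP; rewrite big_nil (big_rem (nth 0%MM A 0)) /=.
    by rewrite addn_eq0 -leqn0 leqNgt [(0 < _)%N](allP A0) // mem_nth ?sA.
  by rewrite mem_nth ?sA.
apply: in_span_sum => i _; have iA : (i < size A)%N by rewrite sA.
rewrite /p -(sum_set_nth _ iA) -mdeg_sum.
have -> : (mdeg a + mdeg (\sum_(b <- A) b)%MM)%N =
    (\sum_(b <- set_nth 0%MM A i (a + nth 0%MM A i)%MM) mdeg b)%N.
  by rewrite -[RHS]mdeg_sum sum_set_nth // mdegD.
apply: IH; first by rewrite size_set_nth_lt.
by apply: all_set_nth => //; rewrite /pos mdegD addn_gt0 [(0 < mdeg a)%N]a0.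
Qed.

(** Peeling off unit vectors one at a time yields as many positive parts as the degree, enough for
    the pigeonhole argument when [mdeg b] is [n.+1]. *)
Lemma sum_units b :
  exists A, [/\ size A = mdeg b, all pos A & (\sum_(a <- A) a)%MM = b].
Proof.
move: {2}(mdeg b) (erefl (mdeg b)) => d; elim: d b => [|d IH] b db.
  by exists [::]; rewrite db big_nil; split=> //; apply/esym/eqP; rewrite -mdeg_eq0 db.
have [i bi] : exists i, (0 < b i)%N.
  apply/existsP; rewrite -[[exists i, _]]negbK negb_exists; apply/negP => /forallP b0.
  suff: mdeg b = 0%N by rewrite db.
  by rewrite mdegE big1 // => i _; have := b0 i; rewrite lt0n negbK => /eqP.
have bE : (U_(i) + (b - U_(i)))%MM = b by rewrite addmC submK // lep1mP -lt0n.
have [A [sA A0 AE]] : exists A,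
    [/\ size A = mdeg (b - U_(i))%MM, all pos A & (\sum_(a <- A) a)%MM = (b - U_(i))%MM].
  by apply: IH; move: db; rewrite -{1}bE mdegD mdeg1 => -[].
exists (U_(i)%MM :: A); rewrite /= /pos mdeg1 big_cons AE bE; split=> //.
by rewrite sA -{2}bE mdegD mdeg1.
Qed.

(* There are no injections of n + 1 indices into n. *)
Lemma psum_decomposable b :
  mdeg b = n.+1 -> in_span (pprod_decomposable n.+1) (psum K n b).
Proof.
move=> db; have [A [sA A0 AE]] := sum_units b.
rewrite db in sA; have := injsum_mod_decomposable sA A0.
rewrite injsum_gt // sub0r AE -mdeg_sum AE db -scaleNr.
set c := - _ => /(in_spanZ c^-1); rewrite scalerA mulVf ?scale1r //.
by rewrite oppr_eq0 mulf_neq0 ?signr_eq0 // pnatr_eq0 -lt0n fact_gt0.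
Qed.

Definition pprod_index d v : Prop :=
  exists2 A, A \in psum_index k n d & v = psum_prod K n A.

Lemma pprod_indexP d B :
  all (fun b => 0 < mdeg b <= n)%N B -> (\sum_(b <- B) mdeg b <= d)%N ->
  pprod_index d (pprod K n B).
Proof.
have pB := perm_eq_seq_mset B.
move=> aB dB; exists (seq_mset B); last by rewrite /psum_prod (perm_big _ pB).
by rewrite inE (perm_all _ pB) aB (perm_big _ pB).
Qed.

Lemma leq_sum_mem B b : b \in B -> (mdeg b <= \sum_(a <- B) mdeg a)%N.
Proof. by move=> bB; rewrite (big_rem b) //= leq_addr. Qed.

(** With a second positive part present, no part can use up the whole degree [n.+1]. *)
Lemma decomposable_in_span v :
  pprod_decomposable n.+1 v -> pprod_index n.+1 v.
Proof.
move=> [B [B0 dB sB ->]]; apply: pprod_indexP; last by rewrite dB.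
apply/allP => b bB; rewrite [(0 < _)%N](allP B0) //= -ltnS -dB (big_rem b) //=.
rewrite -[X in (X < _)%N]addn0 ltn_add2l.
have : all pos (rem b B) by apply/allP => x /mem_rem; apply: (allP B0).
have : size (rem b B) = (size B).-1 by apply: size_rem.
case: (rem b B) => [|x B'] /=; first by case: (size B) sB => [|[]].
by move=> _ /andP[x0 _]; rewrite big_cons addn_gt0 [(0 < mdeg x)%N]x0.
Qed.

Lemma pprod_pos_in_span B :
  all pos B -> (\sum_(b <- B) mdeg b <= n.+1)%N ->
  in_span (pprod_index n.+1) (pprod K n B).
Proof.
move=> B0 dB; have [aB|] := boolP (all (fun b => mdeg b <= n)%N B).
  apply: in_span_gen; apply: pprod_indexP => //.
  by apply/allP => b bB; rewrite [(0 < _)%N](allP B0) //= (allP aB).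
case/allPn => b bB; rewrite -ltnNge => nb.
have pB := perm_to_rem bB.
(* A part of degree above [n] exhausts the degree bound, so it is the only part. *)
have r0 : rem b B = [::].
  have : all pos (rem b B) by apply/allP => x /mem_rem; apply: (allP B0).
  move: dB; rewrite (perm_big _ pB) big_cons /=.
  case: (rem b B) => //= x B'; rewrite big_cons => h /andP[x0 _].
  move: h; rewrite leqNgt addnA => /negP[]; apply: leq_trans (leq_addr _ _).
  by rewrite -[n.+2]addn1 leq_add.
have dbE : mdeg b = n.+1.
  by apply/eqP; rewrite eqn_leq nb andbT (leq_trans _ dB) // leq_sum_mem.
rewrite /pprod (perm_big _ pB) r0 big_seq1.
apply: in_span_trans (psum_decomposable dbE) => v /decomposable_in_span.
exact: in_span_gen.
Qed.

Lemma pprod_in_span B :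
  (\sum_(b <- B) mdeg b <= n.+1)%N ->
  in_span (pprod_index n.+1) (pprod K n B).
Proof.
(* Each zero part contributes the constant factor [n], absorbed into [c]. *)
have [c [-> ->]] : exists c, pprod K n B = c *: pprod K n (filter pos B) /\
    (\sum_(b <- B) mdeg b)%N = (\sum_(b <- filter pos B) mdeg b)%N.
  elim: B => [|b B [c [cE dE]]]; first by exists 1; rewrite scale1r.
  rewrite /= big_cons pprod_cons /pos lt0n; have [b0|b0] /= := eqVneq (mdeg b) 0%N.
    exists (n%:R * c); rewrite b0 -dE; split=> //.
    have/eqP-> : b == 0%MM by rewrite -mdeg_eq0 b0.
    by rewrite psum0 cE -scalerA scaler_nat mulr_natl.
  by exists c; rewrite pprod_cons cE scalerAr big_cons dE.
by move=> dB; apply/in_spanZ/pprod_pos_in_span => //; apply: filter_all.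
Qed.

End Spanning.

(** * Invariants as averages over the symmetric group *)

Section Invariants.
Variables (K : numFieldType) (k n : nat).
Implicit Types (a b : 'X_{1..k}) (A B : seq 'X_{1..k}).
Implicit Types (v : kpoly K k n) (s : 'S_n).

Lemma sym_act_colmnm s j a :
  sym_act s ('X_[colmnm j a] : kpoly K k n) = 'X_[colmnm (s j) a].
Proof.
rewrite -!xvar_prod /sym_act rmorph_prod; apply: eq_bigr => i _.
by rewrite rmorphXn; congr (_ ^+ _); apply: sym_act_xvar.
Qed.

Lemma sym_act_mnm_of s (t : seq 'I_n) A :
  sym_act s ('X_[mnm_of t A] : kpoly K k n) = 'X_[mnm_of (map s t) A].
Proof.
elim: A t => [|a A IH] [|j t] /=; rewrite ?mpolyX0 /sym_act ?comp_mpoly1 //.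
by rewrite !mpolyXD rmorphM /= -!/(sym_act _ _) IH sym_act_colmnm.
Qed.

Lemma sym_act_psum s a : sym_act s (psum K n a) = psum K n a.
Proof.
rewrite psumE /sym_act raddf_sum [RHS](reindex_inj (@perm_inj _ s)) /=.
by apply: eq_bigr => j _; apply: sym_act_colmnm.
Qed.

Lemma sym_act_pprod s A : sym_act s (pprod K n A) = pprod K n A.
Proof.
by rewrite /sym_act rmorph_prod; apply: eq_bigr => a _; apply: sym_act_psum.
Qed.

Lemma msize_pprod A : (msize (pprod K n A) <= (\sum_(a <- A) mdeg a).+1)%N.
Proof.
rewrite (pprodE _ _ (erefl (size A))); set d := (\sum_(a <- A) _)%N.
apply: (big_ind (fun v => (msize v <= d.+1)%N)) => [|u v hu hv|t _].
- by rewrite msize0.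
- by apply: leq_trans (msizeD_le _ _) _; rewrite geq_max hu.
by rewrite msizeX mdeg_mnm_of // size_tuple.
Qed.

Lemma pprod_inv A d :
  (\sum_(a <- A) mdeg a <= d)%N -> pprod K n A \in sym_inv_le K k n d.
Proof.
move=> dA; rewrite inE (leq_trans (msize_pprod A)) //=.
by apply/forallP => s; rewrite sym_act_pprod.
Qed.

Lemma mnm_of_mcol (m : 'X_{1..(k * n)%N}) :
  mnm_of (enum 'I_n) (map (mcol m) (enum 'I_n)) = m.
Proof.
rewrite -[RHS]sum_colmnm -big_enum /=; elim: (enum _) => [|j t IH] /=.
  by rewrite big_nil.
by rewrite big_cons IH.
Qed.

(** Permutations of the columns correspond to injective [n]-tuples of columns. *)
Lemma sum_sym_act A :
  \sum_(s : 'S_n) 'X_[mnm_of (map s (enum 'I_n)) A] = injsum K n n A.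
Proof.
rewrite /injsum (reindex (fun s : 'S_n => mktuple s)) /=.
  apply: eq_big => // s; rewrite /= map_inj_uniq ?enum_uniq //.
  exact: perm_inj.
(* The inverse correspondence; its value on non-injective tuples is arbitrary. *)
pose h (t : n.-tuple 'I_n) : 'S_n :=
  if injectiveP (tnth t) is ReflectT it then perm it else 1%g.
exists h => [s _|t ut]; rewrite /h; case: injectiveP => [it|[]].
- by apply/permP => j; rewrite permE tnth_mktuple.
- by move=> i j; rewrite !tnth_mktuple; apply: perm_inj.
- by apply: eq_from_tnth => j; rewrite tnth_mktuple permE.
by apply/tuple_uniqP.
Qed.

Lemma inv_in_span v :
  v \in sym_inv_le K k n n.+1 -> in_span (@pprod_index K k n n.+1) v.
Proof.
rewrite inE => /andP[dv /forallP sv].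
(* An invariant equals its average, so it suffices to average single monomials. *)
have -> : v = (#|{: 'S_n}|%:R)^-1 *: \sum_(s : 'S_n) sym_act s v.
  rewrite (eq_bigr (fun=> v)) => [|s _]; last exact/eqP.
  rewrite sumr_const -scaler_nat scalerA mulVf ?scale1r // pnatr_eq0 -lt0n.
  by apply/card_gt0P; exists 1%g.
apply: in_spanZ; rewrite {1}[v]mpolyE.
under eq_bigr do rewrite /sym_act raddf_sum /=.
rewrite exchange_big big_seq; apply: in_span_sum => m mv /=.
under eq_bigr do rewrite comp_mpolyZ -/(sym_act _ _).
(* Each monomial is given by its [n] columns, empty ones included, placed by the identity map. *)
rewrite -scaler_sumr -[m in 'X_[m]]mnm_of_mcol.
under eq_bigr do rewrite sym_act_mnm_of.
rewrite sum_sym_act; apply: in_spanZ.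
set A := map _ _; have sA : size A = n by rewrite size_map size_enum_ord.
have dA : (\sum_(a <- A) mdeg a <= n.+1)%N.
  rewrite -(@mdeg_mnm_of k n (enum 'I_n)) ?sA ?size_enum_ord // mnm_of_mcol.
  by rewrite -ltnS (leq_trans _ dv) // msize_mdeg_lt.
apply: in_span_trans (@injsum_in_span K k n predT n A _ sA _) => //.
  by move=> _ [B [_ dB ->]]; apply: pprod_in_span; rewrite dB.
exact: all_predT.
Qed.

End Invariants.

(** * Linear forms that separate the products *)

Section Functionals.
Variables (K : numFieldType) (k n : nat).
Implicit Types (a b : 'X_{1..k}) (A B : seq 'X_{1..k}) (v : kpoly K k n).
Implicit Types (m : 'X_{1..(k * n)%N}) (t : seq 'I_n).

Let pos a := (0 < mdeg a)%N.

(** Coefficients count maps, so in characteristic zero nothing cancels. *)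
Lemma mcoeff_pprod A m :
  (pprod K n A)@_m =
  (\sum_(t : (size A).-tuple 'I_n) (mnm_of t A == m))%N%:R.
Proof.
rewrite (pprodE _ _ (erefl (size A))) raddf_sum natr_sum /=.
by apply: eq_bigr => t _; rewrite mcoeffX.
Qed.

Lemma mcoeff_pprod_neq0 t A :
  size t = size A -> (pprod K n A)@_(mnm_of t A) != 0.
Proof.
move/eqP=> st; rewrite mcoeff_pprod pnatr_eq0 -lt0n.
by rewrite (bigD1 (Tuple st)) //= eqxx.
Qed.

(** A map [u] for [B] with the same monomial has the same image as [t]. As [B] has no more parts
    than [A], [u] is injective too, and reading the columns recovers both lists. *)
Lemma mcoeff_pprod_perm t A B :
  uniq t -> size t = size A -> all pos A -> all pos B ->
  (size B <= size A)%N -> (pprod K n B)@_(mnm_of t A) != 0 -> perm_eq A B.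
Proof.
move=> ut st A0 B0 sBA; rewrite mcoeff_pprod pnatr_eq0 -lt0n.
rewrite lt0n sum_nat_eq0 negb_forall => /existsP[u].
rewrite /= -lt0n lt0b => /eqP uE.
have ut_mem : u =i t.
  move=> j; apply/negb_inj; rewrite -(@mcol_mnm_of_eq0 k n t A) //.
  by rewrite -uE mcol_mnm_of_eq0 ?size_tuple.
have uu : uniq u.
  apply/card_uniqP/eqP; rewrite eqn_leq card_size size_tuple (leq_trans sBA) //.
  by rewrite (eq_card ut_mem) (card_uniqP ut) st.
rewrite -(map_mcol_mnm_of ut st) -[X in perm_eq _ X](map_mcol_mnm_of uu) ?size_tuple //.
by rewrite uE; apply/perm_map/uniq_perm => // j; rewrite ut_mem.
Qed.

(* The values making the summand in [sum_weightS] vanish for 0 < #|t| < n: the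
   sum over all t then vanishes unless some t is surjective. *)
Definition weight r : K := (-1) ^+ r * r.-1`!%:R * (n - r)`!%:R.

Lemma weightS r : (0 < r < n)%N ->
  r%:R * weight r + (n - r)%:R * weight r.+1 = 0.
Proof.
case: r => // r /andP[_ rn]; rewrite /weight /=.
have -> : (n - r.+1)%N = (n - r.+2).+1 by rewrite subnSK.
by rewrite !factS !natrM !exprS; ring.
Qed.

Lemma card_cons_mem j t : #|j :: t| = ((j \notin t) + #|t|)%N.
Proof. by rewrite -cardU1; apply: eq_card => i; rewrite !inE. Qed.

(** Prepending a column to [t] keeps the image in [#|t|] cases and enlarges it by one in the
    others. *)
Lemma sum_weightS r :
  \sum_(t : r.+1.-tuple 'I_n) weight #|t| =
  \sum_(t : r.-tuple 'I_n)
    (#|t|%:R * weight #|t| + (n - #|t|)%:R * weight #|t|.+1).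
Proof.
rewrite (big_tuple_cons r xpredT (fun t => weight #|t|)) /=.
apply: eq_bigr => t _; rewrite (bigID (mem t)) /=; congr (_ + _).
  rewrite (eq_bigr (fun=> weight #|t|)) => [|j jt]; last first.
    by rewrite card_cons_mem jt.
  by rewrite sumr_const mulr_natl.
rewrite (eq_bigr (fun=> weight #|t|.+1)) => [|j jt]; last first.
  by rewrite card_cons_mem jt.
rewrite sumr_const mulr_natl; congr (_ *+ _).
by rewrite -[X in (X - _)%N]card_ord -(cardC (mem t)) addKn.
Qed.

Lemma sum_weight_eq0 r : (0 < r < n)%N ->
  \sum_(t : r.+1.-tuple 'I_n) weight #|t| = 0.
Proof.
case/andP=> r0 rn; rewrite sum_weightS big1 // => t _; apply: weightS.
apply/andP; split; last by rewrite (leq_ltn_trans (card_size t)) ?size_tuple.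
by apply/card_gt0P; exists (tnth t (Ordinal r0)); apply: mem_tnth.
Qed.

(** By [weightS] only the surjective [n]-tuples survive, all with the same nonzero contribution. *)
Lemma sum_weight_neq0 : (0 < n)%N ->
  \sum_(t : n.+1.-tuple 'I_n) weight #|t| != 0.
Proof.
move=> n0; rewrite sum_weightS.
have -> : \sum_(t : n.-tuple 'I_n)
      (#|t|%:R * weight #|t| + (n - #|t|)%:R * weight #|t|.+1) =
    \sum_(t : n.-tuple 'I_n) (#|t| == n)%:R * (n%:R * weight n).
  apply: eq_bigr => t _; have [->|tn] := eqVneq #|t| n.
    by rewrite subnn mul0r addr0 mul1r.
  rewrite weightS ?mul0r //; apply/andP; split.
    by apply/card_gt0P; exists (tnth t (Ordinal n0)); apply: mem_tnth.
  by rewrite ltn_neqAle tn -[X in (_ <= X)%N](size_tuple t) card_size.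
rewrite -mulr_suml -natr_sum !mulf_neq0 ?signr_eq0 ?pnatr_eq0 -?lt0n ?fact_gt0 //.
rewrite (bigD1 (ord_tuple n)) //= -[X in _ == X]card_ord.
by rewrite (eq_card (B := 'I_n)) ?eqxx // => j; rewrite -{1}[j]tnth_ord_tuple mem_tnth.
Qed.

(** The bound [n.+2] keeps the sum finite while covering all monomials of degree at most [n.+1]. *)
Definition top_form b v : K :=
  \sum_(m : 'X_{1..(k * n)%N < n.+2})
    v@_m * (if (\sum_j mcol m j)%MM == b
            then weight #|[pred j | mcol m j != 0%MM]| else 0).

Lemma top_form_sum b (I : Type) (s : seq I) (c : I -> K) (e : I -> kpoly K k n) :
  top_form b (\sum_(i <- s) c i *: e i) = \sum_(i <- s) c i * top_form b (e i).
Proof.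
under [RHS]eq_bigr do rewrite mulr_sumr.
rewrite exchange_big; apply: eq_bigr => m _ /=.
rewrite raddf_sum mulr_suml; apply: eq_bigr => i _.
by rewrite /= mcoeffZ mulrA.
Qed.

Lemma top_formX b m : (mdeg m < n.+2)%N ->
  top_form b 'X_[m] = if (\sum_j mcol m j)%MM == b
    then weight #|[pred j | mcol m j != 0%MM]| else 0.
Proof.
move=> dm; rewrite /top_form (bigD1 (BMultinom dm)) //= mcoeffX eqxx mul1r.
rewrite [X in _ + X]big1 ?addr0 // => m' ne; rewrite mcoeffX [_ == _]negbTE ?mul0r //.
by apply: contra ne => /eqP mm'; apply/eqP/val_inj.
Qed.

(** All maps give the same total exponent vector, and the number of nonzero columns is the size of
    the image. *)
Lemma top_form_pprod b A :
  all pos A -> (\sum_(a <- A) mdeg a <= n.+1)%N ->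
  top_form b (pprod K n A) =
  if (\sum_(a <- A) a)%MM == b
  then \sum_(t : (size A).-tuple 'I_n) weight #|t| else 0.
Proof.
move=> A0 dA; rewrite (pprodE _ _ (erefl (size A))).
transitivity (\sum_(t : (size A).-tuple 'I_n)
    if (\sum_(a <- A) a)%MM == b then weight #|t| else 0); last first.
  by case: eqP => // _; rewrite big1.
rewrite (eq_bigr (fun t : (size A).-tuple 'I_n => 1 *: 'X_[mnm_of t A])) => [|t _];
  last by rewrite scale1r.
rewrite top_form_sum; apply: eq_bigr => t _; rewrite mul1r top_formX; last first.
  by rewrite mdeg_mnm_of ?size_tuple.
rewrite sum_mcol_mnm_of ?size_tuple //; case: eqP => // _.
congr weight; apply: eq_card => j.
by rewrite !inE mcol_mnm_of_eq0 ?size_tuple // negbK.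
Qed.

Lemma leq_size_sum_mdeg A : all pos A -> (size A <= \sum_(a <- A) mdeg a)%N.
Proof.
elim: A => [|a A IH] //= /andP[a0 /IH]; rewrite big_cons -add1n.
exact: leq_add.
Qed.

Lemma all_mdeg1 A :
  all pos A -> (\sum_(a <- A) mdeg a <= size A)%N -> all (fun a => mdeg a == 1)%N A.
Proof.
elim: A => [|a A IH] //= /andP[a0 A0]; rewrite big_cons => h.
have dA := leq_size_sum_mdeg A0.
have a1 : mdeg a = 1%N.
  apply/eqP; rewrite eqn_leq [(0 < _)%N]a0 andbT.
  by rewrite -(leq_add2r (size A)) add1n (leq_trans _ h) // leq_add2l.
by rewrite a1 eqxx IH //; rewrite a1 add1n ltnS in h.
Qed.

Lemma count_units A i : all (fun a => mdeg a == 1)%N A ->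
  count_mem U_(i)%MM A = (\sum_(a <- A) a)%MM i.
Proof.
elim: A => [|a A IH] /=; first by rewrite big_nil mnm0E.
rewrite mdeg_eq1 => /andP[/existsP[j /eqP->] /IH->].
by rewrite big_cons mnmDE mnm1E eq_mnm1.
Qed.

(** Entry [i] of the sum counts the copies of the [i]-th unit vector. *)
Lemma perm_units A B :
  all (fun a => mdeg a == 1)%N A -> all (fun a => mdeg a == 1)%N B ->
  (\sum_(a <- A) a)%MM = (\sum_(b <- B) b)%MM -> perm_eq A B.
Proof.
move=> A1 B1 AB; apply/allP => a; rewrite mem_cat => aAB.
have : mdeg a == 1%N by case/orP: aAB; [apply: (allP A1) | apply: (allP B1)].
by rewrite mdeg_eq1 => /existsP[i /eqP->]; rewrite /= !count_units // AB.
Qed.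

End Functionals.

(** * Linear independence *)

Section Independence.
Variables (K : numFieldType) (k n : nat).
Implicit Types (A B E : {mset 'X_{1..k}}%mset).

Lemma psum_index_pos A :
  A \in psum_index k n n.+1 -> all (fun a => 0 < mdeg a)%N A.
Proof.
rewrite inE => /andP[/allP hA _]; apply/allP => a /hA.
by case/andP.
Qed.

Lemma psum_index_deg A :
  A \in psum_index k n n.+1 -> (\sum_(a <- A) mdeg a <= n.+1)%N.
Proof. by rewrite inE => /andP[]. Qed.

Lemma psum_index_size A :
  A \in psum_index k n n.+1 -> (size A <= n.+1)%N.
Proof.
move=> iA; apply: leq_trans (psum_index_deg iA).
exact/leq_size_sum_mdeg/psum_index_pos.
Qed.

Lemma perm_mset A B : perm_eq A B -> A = B.
Proof. by move/eq_seq_msetP; rewrite !seq_mset_id. Qed.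

(** If the totals agree, [A] has degree [n.+1]. One part would be too large, and [n.+1] parts would
    all be units, forcing [A = E]. The remaining sizes, 2 to [n], have vanishing weight sum. *)
Lemma top_form_eq0 A E :
  A \in psum_index k n n.+1 -> E \in psum_index k n n.+1 ->
  size E = n.+1 -> A != E ->
  top_form (\sum_(a <- E) a)%MM (psum_prod K n A) = 0.
Proof.
move=> iA iE sE AE; rewrite /psum_prod -/(pprod K n A).
have A0 := psum_index_pos iA; have E0 := psum_index_pos iE.
rewrite top_form_pprod ?psum_index_deg //; case: eqP => // sAE.
have dE : (\sum_(a <- E) mdeg a)%N = n.+1.
  apply/eqP; rewrite eqn_leq psum_index_deg //= -{1}sE.
  exact: leq_size_sum_mdeg.
have dA : (\sum_(a <- A) mdeg a)%N = n.+1 by rewrite -mdeg_sum sAE mdeg_sum.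
have sA : (1 < size A <= n)%N.
  apply/andP; split.
    move: iA dA; rewrite inE => /andP[+ _]; case: (A : seq _) => [|a [|a' A']] //=.
      by rewrite big_nil.
    by rewrite big_seq1 => /andP[/andP[_ an] _] aE; rewrite aE ltnn in an.
  rewrite -ltnS ltn_neqAle psum_index_size // andbT; apply: contra AE => /eqP sA.
  apply/eqP/perm_mset/perm_units => //; apply: all_mdeg1; rewrite ?dA ?dE ?sA ?sE //.
case: (size A) sA => // r /andP[r0 rn]; apply: sum_weight_eq0.
by rewrite -ltnS r0.
Qed.

Lemma top_form_neq0 E :
  (0 < n)%N -> E \in psum_index k n n.+1 -> size E = n.+1 ->
  top_form (\sum_(a <- E) a)%MM (psum_prod K n E) != 0.
Proof.
move=> n0 iE sE; rewrite /psum_prod -/(pprod K n E).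
by rewrite top_form_pprod ?psum_index_pos ?psum_index_deg // eqxx sE sum_weight_neq0.
Qed.

Lemma psum_prod_free (s : seq {mset 'X_{1..k}}%mset) (c : {mset 'X_{1..k}}%mset -> K) :
  (0 < n)%N -> uniq s -> {subset s <= psum_index k n n.+1} ->
  \sum_(A <- s) c A *: psum_prod K n A = 0 -> {in s, forall A, c A = 0}.
Proof.
move=> n0 us si sum0.
(* A linear relation is tested by a form [f] under which only the term of [A] survives. *)
have cancel A (f : {mset 'X_{1..k}}%mset -> K) :
    A \in s -> f A != 0 -> \sum_(B <- s) c B * f B = 0 ->
    (forall B, B \in s -> B != A -> c B * f B = 0) -> c A = 0.
  move=> As fA + f0; rewrite (bigD1_seq A) //= big_seq_cond big1 ?addr0.
    by move/eqP; rewrite mulf_eq0 (negbTE fA) orbF => /eqP.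
  by move=> B /andP[Bs BA]; apply: f0.
(* Descending induction on the size of [A], starting from [n.+1] parts at [d = 0]. *)
suff H d A : A \in s -> (n < size A + d)%N -> c A = 0.
  by move=> A As; apply: (H n.+1) => //; rewrite addnS ltnS leq_addl.
elim: d A => [|d IH] A As.
  rewrite addn0 => nA; have sA : size A = n.+1.
    by apply/eqP; rewrite eqn_leq nA psum_index_size ?si.
  apply: (cancel A (fun B => top_form (\sum_(a <- A) a)%MM (psum_prod K n B))) => //.
  - by apply: top_form_neq0; rewrite ?si.
  - by rewrite -top_form_sum sum0 /top_form big1 // => m _; rewrite mcoeff0 mul0r.
  by move=> B Bs BA; rewrite top_form_eq0 ?mulr0 ?si.
rewrite addnS ltnS leq_eqVlt => /orP[/eqP nA|]; last exact: IH.
(* Here [A] has at most [n] parts, so distinct columns are available. *)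
pose t := take (size A) (enum 'I_n).
have ut : uniq t by apply/take_uniq/enum_uniq.
have st : size t = size A.
  by rewrite size_takel // size_enum_ord nA leq_addr.
apply: (cancel A (fun B => (psum_prod K n B)@_(mnm_of t A))) => //.
- exact: mcoeff_pprod_neq0.
- transitivity ((\sum_(B <- s) c B *: psum_prod K n B)@_(mnm_of t A)).
    by rewrite raddf_sum; apply: eq_bigr => B _; rewrite /= mcoeffZ.
  by rewrite sum0 mcoeff0.
(* Larger [B] have zero coefficient by induction; the others do not contain the chosen monomial. *)
move=> B Bs BA; have [AB|BA'] := ltnP (size A) (size B).
  by rewrite IH ?mul0r // nA ltn_add2r.
apply/eqP; rewrite mulf_eq0; apply/orP; right; apply: contraNT BA => h.
apply/eqP/esym/perm_mset/(mcoeff_pprod_perm ut st _ _ BA' h);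
  by apply: psum_index_pos; apply: si.
Qed.

End Independence.

Theorem theorem1 (R : realType) (k n : nat) (hk : (1 <= k)%N) (hn : (1 <= n)%N) :
  is_basis (sym_inv_le R[i] k n n.+1) (psum_index k n n.+1)
    (psum_prod R[i] n) /\
  {in psum_index k n n.+1 &, injective (psum_prod (k := k) R[i] n)}.
Proof.
split; first split.
- by move=> A iA; apply/pprod_inv/psum_index_deg.
- by move=> s c us si sum0; apply: psum_prod_free us si sum0.
- by move=> v /inv_in_span/in_span_uniq.
move=> A B iA iB pAB; apply/eqP; apply: contraT => AB.
(* Equal products would give the nontrivial relation with coefficients 1 and -1. *)
pose c C : R[i] := if C == A then 1 else -1.
have : c A = 0.
  apply: (@psum_prod_free _ k n [:: A; B] c) => //; rewrite ?mem_head //.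
  - by rewrite /= inE AB.
  - by move=> C; rewrite !inE => /orP[/eqP->|/eqP->].
  rewrite big_cons big_seq1 /c eqxx eq_sym (negbTE AB) pAB.
  by rewrite scale1r scaleN1r subrr.
by rewrite /c eqxx => /eqP; rewrite oner_eq0.
Qed.
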